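(* Let $q\in(0,1)$, $c_{-1},c_{+1}\in\mathbb{R}$ and $\delta>0$. Let $S=\{-1,+1\}$ and let $(X_n,\eta_n)_{n\in\mathbb{Z}_+}$, where $\eta_n=X_n-X_{n-1}$, be a time-homogeneous irreducible Markov chain on $\mathbb{Z}_+\times S$ with transition probabilities \[\Pr[(X_{n+1},\eta_{n+1})=(x+j,j)\mid (X_n,\eta_n)=(x,i)]=q_{ij}(x),\quad i,j\in S,\] where, as $x\to\infty$, \[ q_{ij}(x)=\begin{cases} q+\frac{i c_i}{2x}+O(x^{-1-\delta}) & \text{if } j=i,\\ 1-q-\frac{i c_i}{2x}+O(x^{-1-\delta}) & \text{if } j\neq i.\end{cases}\] Let $c=(c_{+1}+c_{-1})/2$. If $c<-q$ then the walk is positive-recurrent; if $c>q$ then the walk is transient; if $|c|\le q$ then the walk is null-recurrent.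
   Context: This is a correlated random walk on $\mathbb{Z}_+$: the particle moves by $\pm1$ at each step, and the law of the next step depends on the current position $x$ and the previous direction of travel $i\in\{-1,+1\}$. *)

(* Defs.v *)
From HB Require Import structures.
From mathcomp Require Import all_boot all_order all_algebra.
From mathcomp Require Import all_classical all_reals all_analysis.
Set Implicit Arguments. Unset Strict Implicit. Unset Printing Implicit Defensive.
Import Order.TTheory GRing.Theory Num.Theory.
Local Open Scope ring_scope.

(* A state (x, i) of Z_+ x S; the sign i in S = {-1,+1} is encoded as a bool
   (true = +1, false = -1). *)
Definition state := (nat * bool)%type.

Definition sgn {R : realType} (b : bool) : R := if b then 1 else -1.

(* The move (x,i) -> (x + j, j). (The truncation of 0 - 1 never matters:
   such moves have probability zero, see [crw_kernel].) *)
Definition step (s : state) (j : bool) : state :=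
  (if j then s.1.+1 else s.1.-1, j).

Fixpoint path_from (s : state) (js : seq bool) : seq state :=
  match js with
  | [::] => [::]
  | j :: js' => step s j :: path_from (step s j) js'
  end.

Fixpoint path_prob {R : realType} (Q : nat -> bool -> bool -> R)
    (s : state) (js : seq bool) : R :=
  match js with
  | [::] => 1
  | j :: js' => Q s.1 s.2 j * path_prob Q (step s j) js'
  end.

Definition crw_kernel {R : realType} (Q : nat -> bool -> bool -> R) : Prop :=
  [/\ forall x i j, 0 <= Q x i j,
      forall x i, Q x i true + Q x i false = 1 &
      forall i, Q 0%N i false = 0].

(* States that the chain can occupy: (0,+1) would require X_{n-1} = -1. *)
Definition valid_state (s : state) : bool := (0 < s.1)%N || ~~ s.2.

Definition nstep {R : realType} (Q : nat -> bool -> bool -> R) (n : nat)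
    (s t : state) : R :=
  \sum_(js : n.-tuple bool | last s (path_from s js) == t) path_prob Q s js.

Definition irreducible {R : realType} (Q : nat -> bool -> bool -> R) : Prop :=
  forall s t, valid_state s -> valid_state t -> exists n, 0 < nstep Q n s t.

Definition first_return (s : state) (js : seq bool) : bool :=
  let ps := path_from s js in
  [&& ps != [::], last s ps == s & s \notin take (size ps).-1 ps].

Definition first_ret {R : realType} (Q : nat -> bool -> bool -> R) (n : nat)
    (s : state) : R :=
  \sum_(js : n.-tuple bool | first_return s js) path_prob Q s js.

Local Open Scope ereal_scope.

Definition return_prob {R : realType} (Q : nat -> bool -> bool -> R)
    (s : state) : \bar R :=
  \sum_(1 <= n <oo) (first_ret Q n s)%:E.

(* E_s[return time to s] (first summing over finite return times). *)
Definition mean_return {R : realType} (Q : nat -> bool -> bool -> R)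
    (s : state) : \bar R :=
  \sum_(1 <= n <oo) (n%:R * first_ret Q n s)%:E.

Definition recurrent {R : realType} (Q : nat -> bool -> bool -> R) (s : state)
  : Prop := return_prob Q s = 1.
Definition transient {R : realType} (Q : nat -> bool -> bool -> R) (s : state)
  : Prop := return_prob Q s < 1.
Definition positive_recurrent {R : realType} (Q : nat -> bool -> bool -> R)
    (s : state) : Prop := recurrent Q s /\ mean_return Q s < +oo.
Definition null_recurrent {R : realType} (Q : nat -> bool -> bool -> R)
    (s : state) : Prop := recurrent Q s /\ mean_return Q s = +oo.

Local Close Scope ereal_scope.

Definition crw_asymptotics {R : realType} (Q : nat -> bool -> bool -> R)
    (q : R) (c : bool -> R) (delta : R) : Prop :=
  exists (C : R) (x0 : nat), forall (x : nat) (i : bool), (0 < x)%N -> (x0 <= x)%N ->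
    `|Q x i i - (q + sgn i * c i / (2 * x%:R))| <= C * (x%:R `^ (-1 - delta))
    /\ `|Q x i (~~ i) - (1 - q - sgn i * c i / (2 * x%:R))|
         <= C * (x%:R `^ (-1 - delta)).

(* Main.v *)
(* Cut the line into edges [k, k+1]; a state is a directed crossing of an edge.
   No net flux crosses an edge under an invariant measure, so the measure gives
   the same mass m_k to both crossings of edge k, with m_{k+1} / m_k =
   q_{++}(k+1) / q_{--}(k+1), whereas the gradient of a harmonic function across
   edge k is proportional to 1 / m_k.  Hence the walk is recurrent iff
   sum 1/m_k diverges (bounded subharmonic functions are then constant), and
   then positive-recurrent iff sum m_k converges (Kac's formula).  By the
   asymptotics m_{k+1} / m_k = 1 + c/(q k) up to a summable error, and a
   Raabe-type comparison decides both series, the boundary cases |c| = q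
   included. *)

Require Import Defs.
From HB Require Import structures.
From mathcomp Require Import all_boot all_order all_algebra.
From mathcomp Require Import all_classical all_reals all_analysis.
From mathcomp Require Import zify ring lra.
Import Order.TTheory GRing.Theory Num.Theory.
Import numFieldNormedType.Exports.
Local Open Scope ring_scope.
Set Implicit Arguments. Unset Strict Implicit. Unset Printing Implicit Defensive.

(** * Return times *)

Lemma big_tupleS (R : nmodType) (T : finType) n (P : pred (seq T))
    (F : seq T -> R) :
  \sum_(js : n.+1.-tuple T | P js) F js =
  \sum_(j : T) \sum_(js : n.-tuple T | P (j :: js)) F (j :: js).
Proof.
rewrite pair_big_dep /= (reindex (fun p : T * n.-tuple T => [tuple of p.1 :: p.2])).
  by apply: eq_bigr => -[j js].
exists (fun js => (thead js, [tuple of behead js])) => [[j js] _ | js _] /=.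
  by congr (_, _); apply: val_inj.
by rewrite [js in RHS]tuple_eta; apply: val_inj.
Qed.

Lemma big_tuple0 (R : nmodType) (T : finType) (P : pred (seq T))
    (F : seq T -> R) :
  \sum_(js : 0.-tuple T | P js) F js = if P [::] then F [::] else 0.
Proof.
case: ifP => P0.
  rewrite (big_pred1 [tuple]) // => js; rewrite tuple0 /=.
  by rewrite P0 eqxx.
by rewrite big_pred0 // => js; rewrite tuple0.
Qed.

(** Abel summation with its boundary term: applied to the probabilities [survive s n s], it turns a
    truncated mean return time into a sum of tails. *)
Lemma sum_by_parts (R : comPzRingType) (g : nat -> R) N :
  \sum_(1 <= n < N.+1) n%:R * (g n.-1 - g n) = \sum_(n < N) (g n - g N).
Proof.
elim: N => [|N IH]; first by rewrite big_geq // big_ord0.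
rewrite big_nat_recr //= IH big_ord_recr /=.
by rewrite !sumrB !sumr_const card_ord; ring.
Qed.

Section ReturnTime.
Context {R : realType} (Q : nat -> bool -> bool -> R).
Hypothesis Qker : crw_kernel Q.

Definition transition (f : state -> R) (t : state) : R :=
  Q t.1 t.2 true * f (step t true) + Q t.1 t.2 false * f (step t false).

(** Killing happens on arrival: [transition (kill s f)] still lets the chain start from [s], so its
    iterates describe returns as well as first visits. *)
Definition kill (s : state) (f : state -> R) (t : state) : R :=
  if t == s then 0 else f t.

(* The probability that the chain started at [t] avoids [s] at times 1..n. *)
Definition survive (s : state) (n : nat) : state -> R :=
  iter n (fun f => transition (kill s f)) (fun=> 1).

Lemma surviveS s n t : survive s n.+1 t = transition (kill s (survive s n)) t.
Proof. by []. Qed.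

(** [first_return] with the start [t] freed from the target [s], as an induction on the first step
    requires. *)
Definition first_hit (s t : state) (js : seq bool) : bool :=
  let ps := path_from t js in
  [&& ps != [::], last t ps == s & s \notin take (size ps).-1 ps].

Lemma path_prob_ge0 t js : 0 <= path_prob Q t js.
Proof.
by case: Qker => Q0 _ _; elim: js t => //= j js IH t; rewrite mulr_ge0.
Qed.

Lemma first_ret_ge0 n s : 0 <= first_ret Q n s.
Proof. by apply: sumr_ge0 => js _; exact: path_prob_ge0. Qed.

Lemma transition_le f g : (forall t, f t <= g t) ->
  forall t, transition f t <= transition g t.
Proof.
by case: Qker => Q0 _ _ fg t; rewrite lerD // ler_wpM2l.
Qed.

Lemma transition_cst (a : R) t : transition (fun=> a) t = a.
Proof. by case: Qker => _ Q1 _; rewrite /transition -mulrDl Q1 mul1r. Qed.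

Lemma killE s f t : kill s f t = (t != s)%:R * f t.
Proof. by rewrite /kill; case: eqP; rewrite (mul0r, mul1r). Qed.

Lemma kill_le s f g : (forall t, f t <= g t) -> forall t, kill s f t <= kill s g t.
Proof. by move=> fg t; rewrite /kill; case: ifP. Qed.

Lemma survive_ge0 s n t : 0 <= survive s n t.
Proof.
elim: n t => //= n IH t; rewrite -[leLHS](transition_cst _ t).
by apply: transition_le => u; rewrite /kill; case: ifP.
Qed.

Lemma survive_decr s n t : survive s n.+1 t <= survive s n t.
Proof.
elim: n t => [|n IH] t /=.
  rewrite -[leRHS](transition_cst _ t).
  by apply: transition_le => u; rewrite /kill; case: ifP => // _; exact: ler01.
by apply: transition_le; apply: kill_le.
Qed.

Lemma survive_homo s t m n : (m <= n)%N -> survive s n t <= survive s m t.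
Proof.
elim: n => [|n IH]; first by rewrite leqn0 => /eqP ->.
rewrite leq_eqVlt => /orP[/eqP -> //|]; rewrite ltnS => /IH.
exact/le_trans/survive_decr.
Qed.

Lemma survive_le1 s n t : survive s n t <= 1.
Proof. exact: (@survive_homo s t 0 n). Qed.

Lemma first_hit_survive s n t :
  \sum_(js : n.+1.-tuple bool | first_hit s t js) path_prob Q t js =
  survive s n t - survive s n.+1 t.
Proof.
elim: n t => [|n IH] t; rewrite big_tupleS big_bool.
  rewrite (big_tuple0 (fun js => first_hit s t (true :: js))
             (fun js => Q t.1 t.2 true * path_prob Q (step t true) js)).
  rewrite (big_tuple0 (fun js => first_hit s t (false :: js))
             (fun js => Q t.1 t.2 false * path_prob Q (step t false) js)).
  rewrite /first_hit /= !andbT /transition /kill.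
  case: Qker => _ Q1 _; rewrite -[X in X - _](Q1 t.1 t.2).
  by do 2 case: ifP => _; ring.
(* A path of length at least two that lands on [s] at its first step is not a first hit, in
   agreement with the zero that [kill] puts at [s]. *)
have E j : \sum_(js : n.+1.-tuple bool | first_hit s t (j :: js))
      path_prob Q t (j :: js) =
    Q t.1 t.2 j * kill s (fun u => survive s n u - survive s n.+1 u) (step t j).
  rewrite /= -mulr_sumr /kill; congr (_ * _); case: eqP => [<-|/eqP ne].
    rewrite big_pred0 // => -[[|i js] //= _].
    by rewrite /first_hit /= mem_head /= andbF.
  rewrite -IH; apply: eq_bigl => -[[|i js] //= _].
  by rewrite /first_hit /= inE negb_or (eq_sym s (step t j)) ne.
transitivity (transition (kill s (fun u => survive s n u - survive s n.+1 u)) t).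
  by rewrite !E.
rewrite (surviveS s n t) (surviveS s n.+1 t).
move: (survive s n.+1) (survive s n) => g f.
by rewrite /transition !killE; ring.
Qed.

Lemma first_retS n s : first_ret Q n.+1 s = survive s n s - survive s n.+1 s.
Proof. exact: first_hit_survive. Qed.

Lemma sum_first_ret s N :
  \sum_(1 <= n < N.+1) first_ret Q n s = 1 - survive s N s.
Proof.
rewrite big_add1 /= -(opprK (\sum_(_ <= _ < _) _)) -sumrN.
under eq_bigr do rewrite first_retS opprB.
by rewrite telescope_sumr //= opprB.
Qed.

Lemma sum_mean_return s N :
  \sum_(1 <= n < N.+1) n%:R * first_ret Q n s =
  \sum_(n < N) (survive s n s - survive s N s).
Proof.
rewrite -(sum_by_parts (survive s ^~ s)) big_nat_cond [RHS]big_nat_cond.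
by apply: eq_bigr => -[|n] // _; rewrite first_retS.
Qed.

Lemma transient_survive s (e : R) : 0 < e -> (forall n, e <= survive s n s) ->
  transient Q s.
Proof.
move=> e0 es; rewrite /transient /return_prob.
apply: (@le_lt_trans _ _ (1 - e)%:E); last by rewrite lte_fin; lra.
apply: lime_le.
  by apply: is_cvg_nneseries => n _ _; rewrite lee_fin first_ret_ge0.
near=> N; have /prednK <- : (0 < N)%N by near: N; exists 1%N.
rewrite sumEFin lee_fin sum_first_ret.
by have := es N.-1; lra.
Unshelve. all: by end_near. Qed.

Lemma recurrent_survive s : (survive s ^~ s @ \oo --> (0 : R))%classic ->
  recurrent Q s.
Proof.
move=> g0; rewrite /recurrent /return_prob.
apply: cvg_lim => //; rewrite -(cvg_shiftS _).
under eq_fun do rewrite sumEFin sum_first_ret.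
apply: cvg_EFin; first exact: nearW.
rewrite -[X in (_ --> X)%classic]subr0.
by apply: cvgB => //; exact: cvg_cst.
Qed.

Lemma mean_return_survive_lt s (M : R) :
  (forall N, \sum_(n < N) survive s n s <= M) -> (mean_return Q s < +oo)%E.
Proof.
move=> gM; rewrite /mean_return; apply: (@le_lt_trans _ _ M%:E); last exact: ltry.
apply: lime_le.
  apply: is_cvg_nneseries => n _ _.
  by rewrite lee_fin mulr_ge0 // first_ret_ge0.
near=> N; have /prednK <- : (0 < N)%N by near: N; exists 1%N.
rewrite sumEFin lee_fin sum_mean_return.
apply: le_trans (gM N.-1); apply: ler_sum => n _.
by rewrite gerBl survive_ge0.
Unshelve. all: by end_near. Qed.

(** The truncated mean is a sum of tails, each reduced by [survive s N s]. Keeping only the first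
    [K] tails, and choosing [N] after [K] so that [K%:R * survive s N s <= 1], costs at most 1. *)
Lemma mean_return_survive_pinfty s :
  (survive s ^~ s @ \oo --> (0 : R))%classic ->
  (forall M : R, exists N, M <= \sum_(n < N) survive s n s) ->
  mean_return Q s = +oo%E.
Proof.
move=> g0 gM; apply/eqyP => A A0; have [K HK] := gM (A + 1).
have [N KN gN] : exists2 N, (K <= N)%N & K%:R * survive s N s <= 1.
  have /cvgrPdist_le /(_ (K.+1%:R^-1)) : (survive s ^~ s @ \oo --> (0 : R))%classic
    by [].
  rewrite invr_gt0 ltr0n => /(_ isT) [N _ HN]; exists (maxn K N).
    exact: leq_maxl.
  have := HN _ (leq_maxr K N); rewrite /= sub0r normrN ger0_norm ?survive_ge0//.
  move=> gN; apply: le_trans (ler_wpM2l _ gN) _ => //.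
  by rewrite ler_pdivrMr ?ltr0n // mul1r ler_nat.
apply: le_trans (nneseries_lim_ge N.+1 _); last first.
  by move=> n _ _; rewrite lee_fin mulr_ge0 // first_ret_ge0.
rewrite sumEFin lee_fin sum_mean_return.
apply: (@le_trans _ _ (\sum_(n < K) (survive s n s - survive s N s))).
  rewrite sumrB sumr_const card_ord -[X in _ - X]mulr_natl; lra.
rewrite -!(big_mkord xpredT (fun n => survive s n s - survive s N s)).
rewrite [leRHS](big_cat_nat (leq0n K) KN) //= lerDl big_nat_cond sumr_ge0 // => n.
by rewrite andbT => /andP[_ nN]; rewrite subr_ge0 survive_homo // ltnW.
Qed.

Lemma cvg_survive s t : cvgn (survive s ^~ t).
Proof.
apply: nonincreasing_is_cvgn.
  by apply/nonincreasing_seqP => n; exact: survive_decr.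
by exists 0 => _ [n _ <-]; exact: survive_ge0.
Qed.

(** The probability that the chain started at [t] never visits [s] at a positive time. *)
Definition escape s t : R := limn (survive s ^~ t).

Lemma escape_ge0 s t : 0 <= escape s t.
Proof.
by apply: limr_ge; [exact: cvg_survive | apply: nearW => n; exact: survive_ge0].
Qed.

Lemma escape_le s n t : escape s t <= survive s n t.
Proof.
apply: nonincreasing_cvgn_ge; last exact: cvg_survive.
by apply/nonincreasing_seqP => k; exact: survive_decr.
Qed.

Lemma escape_transition s t : escape s t = transition (kill s (escape s)) t.
Proof.
apply: cvg_lim => //; rewrite -(cvg_shiftS _) /=.
rewrite /transition !killE; under eq_fun do rewrite !killE.
by apply: cvgD; apply: cvgMl_tmp; apply: cvgMl_tmp; exact: cvg_survive.
Qed.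

End ReturnTime.

Arguments survive {R} Q s n t : simpl never.

Lemma bounded_series_cvg0 (R : realType) (u : nat -> R) (M : R) :
  (forall n, 0 <= u n) -> (forall N, \sum_(n < N) u n <= M) ->
  (u @ \oo --> (0 : R))%classic.
Proof.
move=> u0 uM; apply: cvg_series_cvg_0; apply: nondecreasing_is_cvgn.
  by apply/nondecreasing_seqP => n; rewrite seriesEnat /= big_nat_recr //= lerDl.
by exists M => _ [n _ <-]; rewrite seriesEord; exact: uM.
Qed.

Lemma ler_sum_ord_homo (R : numDomainType) (u : nat -> R) m n :
  (forall k, 0 <= u k) -> (m <= n)%N -> \sum_(k < m) u k <= \sum_(k < n) u k.
Proof.
move=> u0; elim: n => [|n IH]; first by rewrite leqn0 => /eqP ->.
rewrite leq_eqVlt => /orP[/eqP -> //|]; rewrite ltnS => /IH /le_trans; apply.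
by rewrite big_ord_recr /= lerDl.
Qed.

(** * Invariant measure and harmonic functions *)

Section Edges.
Context {R : realType} (Q : nat -> bool -> bool -> R).
Hypothesis Qker : crw_kernel Q.

(* Edge [k] joins [k] and [k.+1]; [up k] and [dn k] are the states reached by
   crossing it in each direction, and they exhaust the valid states. *)
Definition up (k : nat) : state := (k.+1, true).
Definition dn (k : nat) : state := (k, false).
Definition edge (s : state) : nat := if s.2 then s.1.-1 else s.1.

Definition fwd (k : nat) : R := Q k.+1 true true.
Definition bwd (k : nat) : R := Q k.+1 false false.
Definition weight (k : nat) : R := \prod_(i < k) (fwd i / bwd i).

Hypothesis fwd_gt0 : forall k, 0 < fwd k.
Hypothesis bwd_gt0 : forall k, 0 < bwd k.

Lemma validP (P : state -> Prop) :
  (forall k, P (up k)) -> (forall k, P (dn k)) ->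
  forall s, valid_state s -> P s.
Proof. by move=> Pu Pd [[|k] []] // _; [exact: Pd | exact: Pu | exact: Pd]. Qed.

Lemma valid_dn k : valid_state (dn k).
Proof. by rewrite /valid_state orbT. Qed.

Lemma valid_step t j : valid_state (step t j).
Proof. by case: j => //; exact: valid_dn. Qed.

Lemma eq_transition_valid (f g : state -> R) :
  (forall t, valid_state t -> f t = g t) -> transition Q f =1 transition Q g.
Proof. by move=> fg t; rewrite /transition !fg ?valid_step. Qed.

Lemma transition_le_valid (f g : state -> R) :
  (forall t, valid_state t -> f t <= g t) ->
  forall t, transition Q f t <= transition Q g t.
Proof.
by case: Qker => Q0 _ _ fg t; rewrite lerD // ler_wpM2l // fg // valid_step.
Qed.

Lemma fwd_le1 k : fwd k <= 1.
Proof.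
by case: Qker => Q0 Q1 _; rewrite -(Q1 k.+1 true) lerDl.
Qed.

Lemma bwd_le1 k : bwd k <= 1.
Proof.
by case: Qker => Q0 Q1 _; rewrite -(Q1 k.+1 false) lerDr.
Qed.

Lemma transition_up f k :
  transition Q f (up k) = fwd k * f (up k.+1) + (1 - fwd k) * f (dn k).
Proof.
case: Qker => _ Q1 _; rewrite /transition /fwd -(Q1 k.+1 true) /=.
by congr (_ + _ * _); ring.
Qed.

Lemma transition_dnS f k :
  transition Q f (dn k.+1) = (1 - bwd k) * f (up k.+1) + bwd k * f (dn k).
Proof.
case: Qker => _ Q1 _; rewrite /transition /bwd -(Q1 k.+1 false) /=.
by congr (_ * _ + _); ring.
Qed.

Lemma transition_dn0 f : transition Q f (dn 0) = f (up 0).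
Proof.
case: Qker => _ Q1 Q0; rewrite /transition /= Q0 mul0r addr0.
by have := Q1 0%N false; rewrite Q0 addr0 => ->; rewrite mul1r.
Qed.

Lemma weight_gt0 k : 0 < weight k.
Proof. by apply: prodr_gt0 => i _; exact: divr_gt0. Qed.

(* The flux of the invariant measure is the same in both directions across
   every edge; detailed balance at a site then fixes the ratio of weights. *)
Lemma weightS k : weight k.+1 * bwd k = weight k * fwd k.
Proof. by rewrite /weight big_ord_recr /= -mulrA divfK // gt_eqF. Qed.

(** * The invariant measure on finitely many edges *)

Definition mass N (f : state -> R) : R :=
  \sum_(k < N.+1) weight k * (f (up k) + f (dn k)).

(** At sites up to [N], arrivals and departures balance by [weightS]. At site [N.+1] only the
    arrival [up N] is counted, which leaves a transfer of mass [weight N * fwd N] from [dn N] to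
    [up N.+1]. *)
Lemma mass_transition N f :
  mass N (transition Q f) =
  mass N f + weight N * fwd N * (f (up N.+1) - f (dn N)).
Proof.
rewrite /mass; elim: N => [|N IH].
  rewrite !big_ord_recr !big_ord0 /= transition_up transition_dn0.
  by rewrite /weight big_ord0; ring.
rewrite [LHS]big_ord_recr [X in _ = X + _]big_ord_recr /= IH.
rewrite transition_up transition_dnS -weightS; ring.
Qed.

Lemma edge_kill s (f : state -> R) k : valid_state s ->
  f (up k) + f (dn k) =
  kill s f (up k) + kill s f (dn k) + (k == edge s)%:R * f s.
Proof.
move: s; apply: validP => e; rewrite !killE /up /dn /edge /=;
  rewrite !xpair_eqE /= ?andbF ?andbT ?eqSS;
  case: eqP => [->|_] /=; ring.
Qed.

Lemma mass_kill N s (f : state -> R) : valid_state s -> (edge s <= N)%N ->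
  mass N f = mass N (kill s f) + weight (edge s) * f s.
Proof.
move=> vs sN; rewrite /mass.
under eq_bigr do rewrite (edge_kill _ _ vs) mulrDr.
rewrite big_split /=; congr (_ + _).
have sN' : (edge s < N.+1)%N by rewrite ltnS.
rewrite (bigD1 (Ordinal sN')) //= eqxx mul1r big1 ?addr0 // => i.
by rewrite -val_eqE /= => /negbTE ->; rewrite mul0r mulr0.
Qed.

(* A Kac-type identity: on the first [N.+1] edges the weight is invariant up to
   the leakage at edge [N]. *)
Lemma mass_survive N s K : valid_state s -> (edge s <= N)%N ->
  weight (edge s) * (\sum_(n < K) survive Q s n.+1 s) =
  mass N (kill s (survive Q s 0)) - mass N (kill s (survive Q s K)) +
  weight N * fwd N * \sum_(n < K)
    (kill s (survive Q s n) (up N.+1) - kill s (survive Q s n) (dn N)).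
Proof.
move=> vs sN; elim: K => [|K IH]; first by rewrite !big_ord0; ring.
rewrite [in LHS]big_ord_recr [in RHS]big_ord_recr /= mulrDr IH.
have := mass_transition N (kill s (survive Q s K)).
by rewrite -[transition Q _]/(survive Q s K.+1) (mass_kill _ vs sN); lra.
Qed.

(** In [mass_survive] the initial mass is at most [2 * M] and the leakage at most [weight N * K%:R].
    Summable weights tend to 0, so for each [K] some [N] brings the leakage below 1, and the
    resulting bound is free of [K]. *)
Lemma survive_sum_bounded s (M : R) : valid_state s ->
  (forall N, \sum_(k < N) weight k <= M) ->
  exists M', forall K, \sum_(n < K) survive Q s n s <= M'.
Proof.
move=> vs wM; exists (1 + (2 * M + 1) / weight (edge s)) => K.
apply: (@le_trans _ _ (\sum_(n < K.+1) survive Q s n s)).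
  by apply: (@ler_sum_ord_homo _ (survive Q s ^~ s)) => // n; exact: survive_ge0.
rewrite big_ord_recl /= lerD2l ler_pdivlMr ?weight_gt0 // mulrC.
have [N sN wN] : exists2 N, (edge s <= N)%N & weight N * K%:R <= 1.
  have /cvgrPdist_le /(_ (K.+1%:R^-1)) : (weight @ \oo --> (0 : R))%classic.
    by apply: (@bounded_series_cvg0 _ _ M) => // k; exact/ltW/weight_gt0.
  rewrite invr_gt0 ltr0n => /(_ isT) [N _ HN].
  exists (maxn (edge s) N); first exact: leq_maxl.
  have := HN _ (leq_maxr (edge s) N).
  rewrite /= sub0r normrN ger0_norm ?(ltW (weight_gt0 _)) // => wN.
  apply: le_trans (ler_wpM2r _ wN) _ => //.
  by rewrite ler_pdivrMl ?ltr0n // mulr1 ler_nat.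
rewrite (mass_survive _ vs sN).
have G01 n t : 0 <= kill s (survive Q s n) t <= 1.
  by rewrite /kill; case: ifP => _; rewrite ?lexx ?ler01 // survive_ge0 // survive_le1.
have S0 : mass N (kill s (survive Q s 0)) <= 2 * M.
  apply: (@le_trans _ _ (2 * \sum_(k < N.+1) weight k)); last by rewrite ler_pM2l.
  rewrite mulr_sumr; apply: ler_sum => k _; rewrite mulrC ler_wpM2r //.
    exact/ltW/weight_gt0.
  by have /andP[_ ?] := G01 0%N (up k); have /andP[_ ?] := G01 0%N (dn k); lra.
have SK : 0 <= mass N (kill s (survive Q s K)).
  apply: sumr_ge0 => k _; apply: mulr_ge0; first exact/ltW/weight_gt0.
  by have /andP[? _] := G01 K (up k); have /andP[? _] := G01 K (dn k); lra.
have L : \sum_(n < K) (kill s (survive Q s n) (up N.+1) - kill s (survive Q s n) (dn N))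
    <= K%:R.
  rewrite -[leRHS]mulr1 mulr_natl -[K in _ *+ K]card_ord -sumr_const.
  apply: ler_sum => n _.
  have /andP[_ ?] := G01 n (up N.+1); have /andP[? _] := G01 n (dn N).
  lra.
suff : weight N * fwd N * \sum_(n < K)
    (kill s (survive Q s n) (up N.+1) - kill s (survive Q s n) (dn N)) <= 1 by lra.
apply: le_trans wN; rewrite -mulrA; apply: ler_wpM2l; first exact/ltW/weight_gt0.
apply: le_trans (ler_wpM2l (ltW (fwd_gt0 N)) L) _.
by rewrite ler_piMl // fwd_le1.
Qed.

Lemma positive_recurrent_weight s (M : R) : valid_state s ->
  (forall N, \sum_(k < N) weight k <= M) -> positive_recurrent Q s.
Proof.
move=> vs /(survive_sum_bounded vs)[M' sM']; split.
  apply: recurrent_survive => //; apply: bounded_series_cvg0 sM' => n.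
  exact: survive_ge0.
exact: mean_return_survive_lt sM'.
Qed.

(** This gives the leakage in [mass_survive] its sign. To reach [s] from the right the chain must
    pass through [dn k], so avoiding [s] is hardest from there. In the induction, a step from
    [up k.+1] or [dn k.+1] averages values that are all at least the one at [dn k], and the latter
    only decreases with time. *)
Lemma kill_survive_mono s n k : valid_state s -> (edge s <= k)%N ->
  kill s (survive Q s n) (dn k) <= kill s (survive Q s n) (up k.+1) /\
  kill s (survive Q s n) (dn k) <= kill s (survive Q s n) (dn k.+1).
Proof.
move=> vs; have off j : (edge s <= j)%N -> (up j.+1 == s) = false /\ (dn j.+1 == s) = false.
  move: s vs; apply: validP => e; rewrite /edge /up /dn /= !xpair_eqE /= => ej;
    by rewrite ?eqSS ?andbF ?andbT gtn_eqF.
have decr m j : kill s (survive Q s m.+1) (dn j) <= kill s (survive Q s m) (dn j).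
  by apply: kill_le => t; exact: survive_decr.
elim: n k => [|n IH] k sk.
  by rewrite /kill; have [-> ->] := off k sk; case: ifP => _ /=; split.
have [IHu IHd] := IH k sk; have [IHu' IHd'] := IH k.+1 (leqW sk).
have [ou od] := off k sk; have D := decr n k.
have bk := bwd_le1 k; have fk := fwd_le1 k.+1.
have bk0 := bwd_gt0 k; have fk0 := fwd_gt0 k.+1.
split; apply: le_trans D _.
  rewrite [leRHS]/kill ou surviveS transition_up; nra.
rewrite [leRHS]/kill od surviveS transition_dnS; nra.
Qed.

(** With a nonnegative leakage, [mass_survive] bounds the sum of tails below by the mass lost
    between times 0 and [K]. For fixed [N] all of it is lost as [K] grows, because [escape]
    vanishes, and the initial mass is unbounded in [N]. *)
Lemma survive_sum_unbounded s : valid_state s ->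
  (forall t, valid_state t -> escape Q s t = 0) ->
  (forall M : R, exists N, M <= \sum_(k < N) weight k) ->
  forall M : R, exists N, M <= \sum_(n < N) survive Q s n s.
Proof.
move=> vs es wM M.
have w0 k := ltW (weight_gt0 k).
(* The extra [weight (edge s)] pays for the atom at [s] removed by [kill], and the 1 for the mass
   surviving at time [K]. *)
have [N sN HN] : exists2 N, (edge s <= N)%N &
    weight (edge s) * `|M| + weight (edge s) + 1 <= \sum_(k < N.+1) weight k.
  have [N HN] := wM (weight (edge s) * `|M| + weight (edge s) + 1).
  exists (maxn (edge s) N); first exact: leq_maxl.
  by apply: le_trans HN _; apply: (ler_sum_ord_homo (u := weight)) => //; rewrite leqW // leq_maxr.
have [K HK] : exists K, mass N (kill s (survive Q s K)) <= 1.
  have cv : ((fun K => mass N (survive Q s K)) @ \oo --> (0 : R))%classic.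
    rewrite -(_ : \sum_(k < N.+1) weight k * (escape Q s (up k) + escape Q s (dn k)) = 0).
      apply: cvg_big => [|k _]; first exact: add_continuous.
      apply: cvgMl_tmp; apply: cvgD; exact: cvg_survive.
    by apply: big1 => k _; rewrite !es ?valid_dn // addr0 mulr0.
  have /cvgrPdist_le /(_ 1 ltr01) [K _ HK] := cv.
  exists K; have := HK K (leqnn K); rewrite /= sub0r normrN => /ler_normlW.
  apply: le_trans; apply: ler_sum => k _; apply: ler_wpM2l => //.
  by apply: lerD; rewrite /kill; case: ifP => // _; exact: survive_ge0.
exists K.+1; rewrite big_ord_recl /=.
suff H : M <= \sum_(n < K) survive Q s n.+1 s.
  by apply: (le_trans H); rewrite lerDr survive_ge0.
rewrite -(ler_pM2l (weight_gt0 (edge s))).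
apply: (@le_trans _ _ (weight (edge s) * `|M|)); first by rewrite ler_wpM2l // ler_norm.
have leak : 0 <= weight N * fwd N * \sum_(n < K)
    (kill s (survive Q s n) (up N.+1) - kill s (survive Q s n) (dn N)).
  apply: mulr_ge0; first by apply: mulr_ge0 => //; exact: ltW.
  by apply: sumr_ge0 => n _; rewrite subr_ge0; case: (kill_survive_mono n vs sN).
rewrite (mass_survive _ vs sN).
have S0 := mass_kill (survive Q s 0) vs sN.
have S1 : \sum_(k < N.+1) weight k <= mass N (survive Q s 0).
  by apply: ler_sum => k _; rewrite mulrDr mulr1 lerDl.
have G0 : survive Q s 0 s = 1 by [].
rewrite G0 mulr1 in S0; lra.
Qed.

(** Let [W k] be the gradient of [h] across edge [k]. Subharmonicity makes [weight k * W k]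
    nondecreasing and [W] nonnegative. If some [W k] were positive, later gradients would dominate a
    multiple of [(weight j)^-1], and divergence of that series would push [h] above [B]. *)
Lemma subharmonic_constant (h : state -> R) (B kappa : R) k0 :
  (forall M : R, exists N, M <= \sum_(k < N) (weight k)^-1) ->
  0 < kappa -> (forall k, (k0 <= k)%N -> fwd k <= 1 - kappa) ->
  (forall k, h (up k) <= B) ->
  (forall t, valid_state t -> h t <= transition Q h t) ->
  forall t, valid_state t -> h t = h (up 0).
Proof.
move=> Sw kap0 fk hB hsub; pose W k := h (up k) - h (dn k).
(* The inequalities at the two arrivals in site [k.+1] share the difference
   [h (up k.+1) - h (dn k)]; eliminating it relates [W k] to [W k.+1]. *)
have hup k : W k <= fwd k * (h (up k.+1) - h (dn k)).
  by have := hsub (up k) isT; rewrite transition_up /W; lra.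
have hdn k : bwd k * (h (up k.+1) - h (dn k)) <= W k.+1.
  by have := hsub (dn k.+1) isT; rewrite transition_dnS /W; lra.
have WS k : bwd k * W k <= fwd k * W k.+1.
  have := ler_wpM2l (ltW (bwd_gt0 k)) (hup k).
  by have := ler_wpM2l (ltW (fwd_gt0 k)) (hdn k); lra.
have W0 k : 0 <= W k.
  elim: k => [|k IH]; first by have := hsub (dn 0) isT; rewrite transition_dn0 subr_ge0.
  rewrite -(pmulr_rge0 _ (fwd_gt0 k)); apply: le_trans (WS k).
  by apply: mulr_ge0 => //; exact: ltW.
have WM k : weight k * W k <= weight k.+1 * W k.+1.
  rewrite -(ler_pM2l (bwd_gt0 k)) [leRHS]mulrA [bwd k * weight _]mulrC weightS.
  rewrite -mulrA mulrCA ler_pM2l ?weight_gt0 //; exact: WS.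
have hU k : h (up k) + (1 - fwd k) * W k <= h (up k.+1).
  have f1 : 0 <= 1 - fwd k by rewrite subr_ge0 fwd_le1.
  have X0 : 0 <= h (up k.+1) - h (dn k).
    by rewrite -(pmulr_rge0 _ (fwd_gt0 k)); apply: le_trans (hup k).
  have XW : 0 <= h (up k.+1) - h (dn k) - W k.
    by have := hup k; have := mulr_ge0 f1 X0; lra.
  by have := hup k; have := mulr_ge0 f1 XW; rewrite /W; lra.
have hUS k : h (up k) <= h (up k.+1).
  by apply: le_trans (hU k); rewrite lerDl mulr_ge0 // subr_ge0 fwd_le1.
have WZ k : W k = 0.
  apply/eqP; rewrite eq_le W0 andbT leNgt; apply/negP => Wk.
  pose m := maxn k k0; pose S n := \sum_(j < n) (weight j)^-1.
  pose d := weight k * W k.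
  have d0 : 0 < d by rewrite mulr_gt0 // weight_gt0.
  have dW j : (k <= j)%N -> d <= weight j * W j.
    elim: j => [|j IH]; first by rewrite leqn0 => /eqP <-.
    rewrite leq_eqVlt => /orP[/eqP <- //|]; rewrite ltnS => /IH dj.
    exact: le_trans dj (WM j).
  (* By [hU] only the share [1 - fwd k] of each gradient is sure to be gained along the [up] states;
     [kappa] bounds that share below. *)
  have grow n : h (up m) + kappa * d * (S (m + n)%N - S m) <= h (up (m + n)%N).
    elim: n => [|n IH]; first by rewrite addn0 subrr mulr0 addr0.
    have SS : S (m + n).+1 = S (m + n)%N + (weight (m + n)%N)^-1.
      by rewrite /S big_ord_recr.
    rewrite addnS SS; apply: le_trans (hU _).
    have Wd : d * (weight (m + n)%N)^-1 <= W (m + n)%N.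
      by rewrite ler_pdivrMr ?weight_gt0 // mulrC dW // (leq_trans (leq_maxl _ _) (leq_addr _ _)).
    have f1 := fk (m + n)%N (leq_trans (leq_maxr _ _) (leq_addr _ _)).
    have : kappa * (d * (weight (m + n)%N)^-1) <= (1 - fwd (m + n)%N) * W (m + n)%N.
      apply: ler_pM => //; [exact: ltW | | lra].
      by rewrite mulr_ge0 ?invr_ge0 // ltW // weight_gt0.
    by lra.
  have [N HN] := Sw (S m + (`|B - h (up m)| + 1) / (kappa * d)).
  have HN' : S m + (`|B - h (up m)| + 1) / (kappa * d) <= S (m + N)%N.
    apply: le_trans HN _.
    apply: (ler_sum_ord_homo (u := fun k => (weight k)^-1)); last exact: leq_addl.
    by move=> j; rewrite invr_ge0 ltW // weight_gt0.
  have : `|B - h (up m)| + 1 <= kappa * d * (S (m + N)%N - S m).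
    by rewrite [leRHS]mulrC -ler_pdivrMr ?(mulr_gt0 kap0 d0) // lerBrDl.
  have := grow N; have := hB (m + N)%N; have := ler_norm (B - h (up m)); lra.
have dnup k : h (dn k) = h (up k) by apply/esym/eqP; rewrite -subr_eq0 -/(W k) WZ.
have upC k : h (up k) = h (up 0).
  elim: k => // k <-; apply/eqP; rewrite eq_le hUS andbT.
  have := hdn k; rewrite WZ dnup pmulr_rle0 // subr_le0; exact.
by apply: validP => k //; rewrite dnup.
Qed.

(** Once set to 0 at [s], the escape probability is bounded and subharmonic, hence constant, and its
    value at [s] makes the constant 0. *)
Lemma escape_eq0 s (kappa : R) k0 : valid_state s ->
  (forall M : R, exists N, M <= \sum_(k < N) (weight k)^-1) ->
  0 < kappa -> (forall k, (k0 <= k)%N -> fwd k <= 1 - kappa) ->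
  forall t, valid_state t -> escape Q s t = 0.
Proof.
move=> vs Sw kap0 fk; pose h := kill s (escape Q s).
have hsub t : valid_state t -> h t <= transition Q h t.
  move=> vt; rewrite -escape_transition // /h /kill.
  by case: ifP => // _; exact: escape_ge0.
have hB k : h (up k) <= 1.
  rewrite /h /kill; case: ifP => _; first exact: ler01.
  exact: (escape_le Qker s 0).
have hC := subharmonic_constant Sw kap0 fk hB hsub.
have h0 t : valid_state t -> h t = 0.
  by move=> vt; rewrite hC // -(hC s vs) /h /kill eqxx.
move=> t vt; rewrite escape_transition // (eq_transition_valid h0).
exact: transition_cst.
Qed.

Lemma survive_cvg0 s (kappa : R) k0 : valid_state s ->
  (forall M : R, exists N, M <= \sum_(k < N) (weight k)^-1) ->
  0 < kappa -> (forall k, (k0 <= k)%N -> fwd k <= 1 - kappa) ->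
  (survive Q s ^~ s @ \oo --> (0 : R))%classic.
Proof.
move=> vs Sw kap0 fk; rewrite -(escape_eq0 vs Sw kap0 fk vs).
exact: cvg_survive.
Qed.

Lemma null_recurrent_weight s (kappa : R) k0 : valid_state s ->
  (forall M : R, exists N, M <= \sum_(k < N) weight k) ->
  (forall M : R, exists N, M <= \sum_(k < N) (weight k)^-1) ->
  0 < kappa -> (forall k, (k0 <= k)%N -> fwd k <= 1 - kappa) ->
  null_recurrent Q s.
Proof.
move=> vs Sw Sv kap0 fk; have g0 := survive_cvg0 vs Sv kap0 fk.
split; first exact: recurrent_survive.
apply: mean_return_survive_pinfty => //.
exact: survive_sum_unbounded (escape_eq0 vs Sv kap0 fk) Sw.
Qed.

(** * Transience *)

Lemma harmonic_constant (h : state -> R) :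
  (forall t, valid_state t -> h t = transition Q h t) ->
  forall t, valid_state t -> h t = h (dn 0).
Proof.
move=> hh; suff H k : h (up k) = h (dn 0) /\ h (dn k) = h (dn 0).
  by apply: validP => k; case: (H k).
(* The equations determine [h] outwards from [dn 0]: the one at [up k] yields [up k.+1], then the
   one at [dn k.+1] yields [dn k.+1] itself. *)
elim: k => [|k [IHu IHd]].
  by split=> //; have := hh (dn 0) isT; rewrite transition_dn0.
have hu : h (up k.+1) = h (dn 0).
  have := hh (up k) isT; rewrite transition_up IHu IHd => e.
  apply: (mulfI (lt0r_neq0 (fwd_gt0 k))); lra.
by split=> //; have := hh (dn k.+1) isT; rewrite transition_dnS hu IHd => ->; ring.
Qed.

(* Subharmonic, and harmonic except at [dn 0]: its discrete gradient across
   edge [k] is [(weight k)^-1], the reciprocal of the invariant measure. *)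
Definition potential (t : state) : R :=
  \sum_(i < edge t) (1 - bwd i) / fwd i / weight i +
  (if t.2 then (weight (edge t))^-1 else 0).

Lemma potential_up k : potential (up k) = potential (dn k) + (weight k)^-1.
Proof. by rewrite /potential /edge /= addr0. Qed.

Lemma potential_dnS k :
  potential (dn k.+1) = potential (dn k) + (1 - bwd k) / fwd k / weight k.
Proof. by rewrite /potential /edge /= !addr0 big_ord_recr. Qed.

Lemma weight_invS k : (weight k.+1)^-1 = bwd k / fwd k / weight k.
Proof.
apply: (mulIf (lt0r_neq0 (weight_gt0 k.+1))).
rewrite mulVf ?lt0r_neq0 ?weight_gt0 // /weight big_ord_recr /= -/(weight k).
by field; rewrite !lt0r_neq0 ?weight_gt0.
Qed.

Lemma potential_upS k :
  potential (up k.+1) = potential (dn k) + (weight k)^-1 / fwd k.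
Proof.
rewrite potential_up potential_dnS weight_invS.
by field; rewrite !lt0r_neq0 ?weight_gt0.
Qed.

Lemma potential_subharmonic t : valid_state t ->
  potential t <= transition Q potential t.
Proof.
move: t; apply: validP => [k|[|k]].
- rewrite transition_up potential_up potential_upS le_eqVlt; apply/orP; left.
  by apply/eqP; field; rewrite !lt0r_neq0 ?weight_gt0.
- by rewrite transition_dn0 potential_up lerDl invr_ge0 ltW // weight_gt0.
- rewrite transition_dnS potential_dnS potential_upS le_eqVlt; apply/orP; left.
  by apply/eqP; field; rewrite !lt0r_neq0 ?weight_gt0.
Qed.

Lemma potential_bounded (M kappa : R) :
  (forall N, \sum_(k < N) (weight k)^-1 <= M) ->
  0 < kappa -> (forall k, kappa <= fwd k) ->
  exists B, forall t, valid_state t -> potential t <= B.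
Proof.
move=> SM kap0 kf; exists (kappa^-1 * M + M).
have wi k : 0 <= (weight k)^-1 by rewrite invr_ge0 ltW // weight_gt0.
have M0 : 0 <= M by have := SM 0%N; rewrite big_ord0.
have wM k : (weight k)^-1 <= M.
  by apply: le_trans (SM k.+1); rewrite big_ord_recr /= lerDr sumr_ge0.
have dnM k : potential (dn k) <= kappa^-1 * M.
  rewrite /potential /edge /= addr0.
  apply: (@le_trans _ _ (kappa^-1 * \sum_(i < k) (weight i)^-1)).
    rewrite mulr_sumr; apply: ler_sum => i _; apply: ler_wpM2r => //.
    have := bwd_gt0 i; have := bwd_le1 i; move=> b1 b0.
    apply: (@le_trans _ _ (fwd i)^-1); last by rewrite lef_pV2 // posrE.
    by rewrite ler_piMl ?invr_ge0 ?ltW //; lra.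
  by rewrite ler_wpM2l // invr_ge0 ltW.
apply: validP => k; last by have := dnM k; lra.
by rewrite potential_up lerD.
Qed.

(** By contradiction: a zero escape probability at [s] would force the bounded subharmonic
    [potential] to attain its maximum at [s], although it increases strictly along the [up] states
    far enough to the right. *)
Lemma transient_weight s (M kappa : R) k0 : valid_state s ->
  (forall N, \sum_(k < N) (weight k)^-1 <= M) ->
  0 < kappa -> (forall k, kappa <= fwd k) ->
  (forall k, (k0 <= k)%N -> fwd k <= 1 - kappa) ->
  transient Q s.
Proof.
move=> vs SM kap0 kf fk.
apply: (transient_survive Qker (e := escape Q s s)); last first.
  by move=> n; exact: escape_le.
rewrite lt_neqAle escape_ge0 // andbT; apply/negP => /eqP es0.
have killg : kill s (escape Q s) =1 escape Q s.
  by move=> t; rewrite /kill; case: eqP => // ->.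
(* Since [escape] vanishes at [s], killing there does not change it, so it is harmonic and therefore
   constant. *)
have g0 t : valid_state t -> escape Q s t = 0.
  have hh := harmonic_constant (h := escape Q s) => vt.
  rewrite hh // -?(hh _ s vs) // => u vu; rewrite {1}escape_transition //;
    by apply: eq_transition_valid => w _; exact: killg.
have [B HB] := potential_bounded SM kap0 kf.
pose C := B - potential s.
have C0 : 0 <= C by rewrite subr_ge0 HB.
(* Optional stopping at the hitting time of [s]: up to time [n] the excess over [potential s] comes
   only from surviving paths, where it is at most [C]. *)
have le n : forall t, valid_state t -> potential t - potential s <= C * survive Q s n t.
  elim: n => [|n IH] t vt; first by rewrite mulr1 lerD2r HB.
  have C1 : C * survive Q s n.+1 t =
      transition Q (fun u => C * kill s (survive Q s n) u) t.
    by rewrite surviveS /transition; ring.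
  rewrite C1; apply: (@le_trans _ _ (transition Q (fun u => potential u - potential s) t)).
    rewrite -[X in _ - X <= _](transition_cst Qker _ t).
    have := potential_subharmonic vt; rewrite /transition; lra.
  apply: transition_le_valid => u vu; rewrite /kill.
  by case: eqP => [->|_]; [rewrite subrr mulr0 | exact: IH].
have pot_le t : valid_state t -> potential t <= potential s.
  move=> vt; rewrite -subr_le0 -(mulr0 C) -(g0 t vt).
  have cv : (C * survive Q s n t @[n --> \oo] --> C * escape Q s t)%classic.
    by apply: cvgMl_tmp; exact: cvg_survive.
  rewrite -(cvg_lim _ cv) //; apply: limr_ge; first exact: cvgP cv.
  by apply: nearW => n; exact: le.
have step_gt k : potential (up k.+1) - potential (up k) = (weight k)^-1 * (1 - fwd k) / fwd k.
  rewrite potential_upS potential_up.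
  by field; rewrite !lt0r_neq0 ?weight_gt0.
have wi k : 0 < (weight k)^-1 by rewrite invr_gt0 weight_gt0.
have step_ge k : potential (up k) <= potential (up k.+1).
  rewrite -subr_ge0 step_gt; apply: mulr_ge0; last by rewrite invr_ge0 ltW.
  by apply: mulr_ge0; [exact: ltW | rewrite subr_ge0 fwd_le1].
have up_homo m n : (m <= n)%N -> potential (up m) <= potential (up n).
  elim: n => [|n IH]; first by rewrite leqn0 => /eqP ->.
  rewrite leq_eqVlt => /orP[/eqP -> //|]; rewrite ltnS => /IH.
  by move=> /le_trans; apply.
have s_le : potential s <= potential (up (edge s)).
  by move: s vs {es0 killg g0 C C0 le pot_le}; apply: validP => k //; rewrite potential_up lerDl ltW.
pose m := maxn (edge s) k0.
have := pot_le (up m.+1) isT; apply/negP; rewrite -ltNge.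
apply: le_lt_trans s_le _; apply: le_lt_trans (up_homo _ m (leq_maxl _ _)) _.
rewrite -subr_gt0 step_gt; apply: mulr_gt0; last by rewrite invr_gt0.
by apply: mulr_gt0 => //; have := fk m (leq_maxr _ _); lra.
Qed.

End Edges.

(** * Consequences of irreducibility *)

(** A path of positive probability never leaves a closed set; irreducibility will be contradicted by
    exhibiting such a set. *)
Lemma nstep_closed (R : realType) (Q : nat -> bool -> bool -> R)
    (A : pred state) n s t :
  crw_kernel Q ->
  (forall u j, A u -> Q u.1 u.2 j != 0 -> A (step u j)) ->
  A s -> 0 < nstep Q n s t -> A t.
Proof.
move=> Qker clA As; apply: contraTT => nAt; rewrite /nstep big1 ?ltxx //.
move=> js /eqP et; apply/eqP; apply: contraNT nAt; rewrite -{}et.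
elim: (val js) s As => //= j l IH s As.
by rewrite mulf_eq0 negb_or => /andP[/(clA _ _ As) /IH H /H].
Qed.

Lemma irreducible_fwd_gt0 (R : realType) (Q : nat -> bool -> bool -> R) :
  crw_kernel Q -> irreducible Q -> forall k, 0 < fwd Q k.
Proof.
move=> Qker irr k; have [Q0 _ _] := Qker.
rewrite lt_neqAle Q0 andbT eq_sym; apply/negP => /eqP fk.
have [n] := irr (dn 0) (up k.+1) isT isT.
(* If [fwd k = 0], the chain is trapped in the positions up to [k] together with [up k]. *)
pose A (u : state) := (u.1 <= k)%N || ((u.1 == k.+1) && u.2).
move=> /(@nstep_closed _ _ A _ _ _ Qker) H; suff : A (up k.+1) by rewrite /A /=; lia.
apply: H => // -[x i j]; rewrite /A /=; case: (x =P k.+1) => [->|].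
  by case: i j => -[] //=; rewrite -/(fwd Q k) ?fk ?eqxx //; lia.
by case: i j => -[] /=; lia.
Qed.

Lemma irreducible_bwd_gt0 (R : realType) (Q : nat -> bool -> bool -> R) :
  crw_kernel Q -> irreducible Q -> forall k, 0 < bwd Q k.
Proof.
move=> Qker irr k; have [Q0 _ _] := Qker.
rewrite lt_neqAle Q0 andbT eq_sym; apply/negP => /eqP bk.
have [n] := irr (dn k.+1) (dn 0) isT isT.
(* If [bwd k = 0], the chain is trapped in the positions beyond [k.+1] together with [dn k.+1]. *)
pose A (u : state) := (k.+1 < u.1)%N || ((u.1 == k.+1) && ~~ u.2).
move=> /(@nstep_closed _ _ A _ _ _ Qker) H; suff : A (dn 0) by [].
apply: H; last by rewrite /A /= eqxx orbT.
move=> -[x i j]; rewrite /A /=; case: (x =P k.+1) => [->|].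
  by case: i j => -[] //=; rewrite -/(bwd Q k) ?bk ?eqxx //; lia.
by case: i j => -[] /=; lia.
Qed.

(** * Series of products of ratios *)

Lemma harmonic_unbounded (R : realType) (m : nat) (M : R) :
  exists N, M <= \sum_(k < N) (m + k).+1%:R^-1.
Proof.
have := @dvg_harmonic R; apply: contra_notP => nM.
apply: nondecreasing_is_cvgn.
  by apply/nondecreasing_seqP => n; rewrite seriesEnat /= big_nat_recr //= lerDl.
exists (\sum_(k < m) k.+1%:R^-1 + M) => _ [n _ <-]; rewrite seriesEord /=.
apply: (@le_trans _ _ (\sum_(k < m + n) k.+1%:R^-1)).
  apply: (@ler_sum_ord_homo _ (fun k => k.+1%:R^-1)); last exact: leq_addl.
  by move=> k; rewrite invr_ge0.
rewrite big_split_ord /= lerD2l leNgt; apply/negP => /ltW Mn.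
by apply: nM; exists n.
Qed.

Section RatioProducts.
Context {R : realType} (A B : nat -> R).
Hypothesis A_gt0 : forall k, 0 < A k.
Hypothesis B_gt0 : forall k, 0 < B k.

Let mu k : R := \prod_(i < k) (A i / B i).

Let mu_gt0 k : 0 < mu k.
Proof. by apply: prodr_gt0 => i _; exact: divr_gt0. Qed.

Let muS k : mu k.+1 = mu k * (A k / B k).
Proof. by rewrite /mu big_ord_recr. Qed.

(* Raabe's test, by telescoping [k * mu k]. *)
Lemma sum_ratio_bounded (g : R) k0 : 1 < g ->
  (forall k, (k0 <= k)%N -> k.+1%:R * A k <= (k.+1%:R - g) * B k) ->
  exists M, forall N, \sum_(k < N) mu k <= M.
Proof.
move=> g1 H; pose S N := \sum_(k < N) mu k.
have SS N : S N.+1 = S N + mu N by rewrite /S big_ord_recr.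
(* The hypothesis reads [k.+1%:R * mu k.+1 <= (k.+1%:R - g) * mu k], so
   [(g - 1) * S k + k%:R * mu k] is nonincreasing from [k0] on. *)
have T n : (g - 1) * S (k0 + n)%N + (k0 + n)%:R * mu (k0 + n)%N <=
    (g - 1) * S k0 + k0%:R * mu k0.
  elim: n => [|n IH]; first by rewrite addn0.
  apply: le_trans IH; rewrite addnS SS.
  have := H (k0 + n)%N (leq_addr _ _); move: (k0 + n)%N => k Hk.
  suff : k.+1%:R * mu k.+1 <= (k.+1%:R - g) * mu k by rewrite -natr1; lra.
  rewrite muS [leLHS]mulrCA [leRHS]mulrC ler_pM2l // mulrA ler_pdivrMr //.
exists (((g - 1) * S k0 + k0%:R * mu k0) / (g - 1)) => N.
have g0 : 0 < g - 1 by rewrite subr_gt0.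
rewrite ler_pdivlMr // mulrC; apply: le_trans (T N).
rewrite -[leLHS]addr0; apply: lerD; last by rewrite mulr_ge0 // ltW.
rewrite ler_pM2l //; apply: (@ler_sum_ord_homo _ mu); last exact: leq_addl.
by move=> k; exact: ltW.
Qed.

(* [k * mu k] loses at most the summable factor [1 - (v k - v k.+1)], so that
   [mu k] dominates a multiple of [1 / k]. *)
Lemma sum_ratio_unbounded (v : nat -> R) k0 :
  (0 < k0)%N -> (forall k, 0 <= v k) -> v k0 <= 1 / 2 ->
  (forall k, (k0 <= k)%N -> v k.+1 <= v k) ->
  (forall k, (k0 <= k)%N ->
     k%:R * B k * (1 - (v k - v k.+1)) <= k.+1%:R * A k) ->
  forall M : R, exists N, M <= \sum_(k < N) mu k.
Proof.
move=> k00 v0 vk0 vS H M; pose z k := k%:R * mu k.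
have z0 k : 0 <= z k by rewrite mulr_ge0 // ltW.
have zk0 : 0 < z k0 by rewrite mulr_gt0 // ltr0n.
have zS k : (k0 <= k)%N -> z k * (1 - (v k - v k.+1)) <= z k.+1.
  move=> kk; have := H k kk; rewrite /z muS => Hk.
  rewrite [X in X <= _]mulrAC [leRHS]mulrCA [leLHS]mulrC ler_pM2l // mulrA.
  by rewrite ler_pdivlMr // mulrAC.
(* A product of factors [1 - e] is at least 1 minus the sum of the losses [e], which telescopes
   here; [v k0 <= 1 / 2] then preserves half of [z k0]. *)
have zn n : z k0 * (1 - (v k0 - v (k0 + n)%N)) <= z (k0 + n)%N.
  elim: n => [|n IH]; first by rewrite addn0 subrr subr0 mulr1.
  rewrite addnS; have kk := leq_addr n k0; move: (k0 + n)%N kk IH => k kk IH.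
  apply: le_trans (zS k kk).
  have e0 : 0 <= v k - v k.+1 by rewrite subr_ge0 vS.
  have a0 : 0 <= v k0 - v k.
    rewrite subr_ge0 -(subnK kk); elim: (k - k0)%N => // j; apply: le_trans.
    by rewrite addSn vS // leq_addl.
  have e1 : 0 <= 1 - (v k - v k.+1) by have := v0 k.+1; lra.
  have := ler_wpM2r e1 IH; have := mulr_ge0 (ltW zk0) (mulr_ge0 a0 e0); lra.
have mun n : z k0 / 2 * (k0 + n).+1%:R^-1 <= mu (k0 + n)%N.
  have kn : (0 < k0 + n)%N by rewrite addn_gt0 k00.
  apply: (@le_trans _ _ (z k0 / 2 * (k0 + n)%:R^-1)).
    apply: ler_wpM2l; first by rewrite divr_ge0 // ltW.
    by rewrite lef_pV2 ?posrE ?ltr0n // ler_nat.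
  rewrite ler_pdivrMr ?ltr0n // [leRHS]mulrC; apply: le_trans (zn n).
  rewrite ler_pM2l //; have := v0 (k0 + n)%N; lra.
have [N HN] := harmonic_unbounded k0 (`|M| / (z k0 / 2)).
exists (k0 + N)%N; rewrite big_split_ord /=.
have S0 : 0 <= \sum_(i < k0) mu i by apply: sumr_ge0 => i _; exact: ltW.
suff : `|M| <= \sum_(i < N) mu (k0 + i)%N by have := ler_norm M; lra.
apply: (@le_trans _ _ (\sum_(k < N) z k0 / 2 * (k0 + k).+1%:R^-1)).
  by rewrite -mulr_sumr mulrC -ler_pdivrMr // divr_gt0.
by apply: ler_sum => i _; exact: mun.
Qed.

End RatioProducts.

(** * Error terms and ratios with prescribed asymptotics *)

Lemma exists_nat_ge (R : realType) (y : R) : exists N : nat, y <= N%:R.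
Proof.
exists (Num.Def.archi_bound `|y|); apply: le_trans (ler_norm y) _.
exact/ltW/archi_boundP.
Qed.

Lemma powRN_small (R : realType) (delta e : R) : 0 < delta -> 0 < e ->
  exists N, forall k, (N <= k)%N -> k.+1%:R `^ (- delta) <= e.
Proof.
move=> d0 e0; have [N HN] := exists_nat_ge (e^-1 `^ delta^-1).
exists N => k Nk; rewrite powRN invf_ple ?posrE ?powR_gt0 ?ltr0n //.
have -> : e^-1 = (e^-1 `^ delta^-1) `^ delta.
  by rewrite -powRrM mulVf ?lt0r_neq0 // powRr1 // invr_ge0 ltW.
apply: ge0_ler_powR; rewrite ?nnegrE ?powR_ge0 //; first exact: ltW.
by apply: le_trans HN _; rewrite ler_nat leqW.
Qed.

Lemma invn_small (R : realType) (e : R) : 0 < e ->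
  exists N, forall k, (N <= k)%N -> k.+1%:R^-1 <= e.
Proof.
move=> e0; have [N HN] := exists_nat_ge e^-1; exists N => k Nk.
rewrite invf_ple ?posrE ?ltr0n //; apply: le_trans HN _.
by rewrite ler_nat leqW.
Qed.

(** Summability of the error in telescoping form. Dividing by [x ^ (- delta)] reduces it to a bound
    on [(x / (x + 1)) ^ delta], obtained from [ln (1 - y) <= - y] and [1 + u <= exp u]; the constant
    [2 + delta] absorbs the passage from [x] to [x + 1 + delta] for [1 <= x]. *)
Lemma powRN_telescope (R : realType) (delta x : R) : 0 < delta -> 1 <= x ->
  x `^ (-1 - delta) <= (2 + delta) / delta * (x `^ (- delta) - (x + 1) `^ (- delta)).
Proof.
move=> d0 x1; have x0 : 0 < x by lra.
have xp : x != 0 by rewrite gt_eqF.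
rewrite powRD; last by rewrite xp implybT.
rewrite powR_inv1; last exact: ltW.
have y0 : 0 < x + 1 by lra.
have -> : (x + 1) `^ (- delta) = x `^ (- delta) * (x / (x + 1)) `^ delta.
  rewrite powRM ?invr_ge0; [|exact: ltW|exact: ltW].
  rewrite -[(x + 1)^-1]powR_inv1; last exact: ltW.
  rewrite -powRrM mulN1r [x `^ _]powRN mulrA mulVf ?mul1r //.
  by rewrite lt0r_neq0 // powR_gt0.
have P : (x / (x + 1)) `^ delta <= (x + 1) / (x + 1 + delta).
  rewrite /powR gt_eqF ?divr_gt0 //.
  have -> : x / (x + 1) = 1 + (- (x + 1)^-1) by field; lra.
  have L : ln (1 + (- (x + 1)^-1)) <= - (x + 1)^-1.
    by apply: le_ln1Dx; rewrite ltrN2 invf_lt1; lra.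
  apply: (@le_trans _ _ (expR (- (delta / (x + 1))))).
    by rewrite ler_expR -mulrN ler_pM2l.
  have z0 : 0 < x + 1 + delta by lra.
  rewrite expRN -[leRHS]invf_div lef_pV2 ?posrE ?expR_gt0 ?divr_gt0 //.
  apply: le_trans (expR_ge1Dx _).
  by rewrite le_eqVlt; apply/orP; left; apply/eqP; field; lra.
rewrite mulrC -[X in _ * (X - _)]mulr1 -mulrBr mulrCA ler_pM2l ?powR_gt0 //.
apply: (@le_trans _ _ ((2 + delta) / delta * (delta / (x + 1 + delta)))).
  rewrite mulrA divfK ?gt_eqF // ler_pdivlMr; last by lra.
  by rewrite mulrC ler_pdivrMr //; nra.
apply: ler_wpM2l; first by rewrite divr_ge0 //; lra.
suff -> : delta / (x + 1 + delta) = 1 - (x + 1) / (x + 1 + delta) by lra.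
by field; lra.
Qed.

Section RatioAsymptotics.
Context {R : realType}.
Variables (A B : nat -> R) (q alpha beta C delta : R) (k0 : nat).
Hypothesis A_gt0 : forall k, 0 < A k.
Hypothesis B_gt0 : forall k, 0 < B k.
Hypothesis q_gt0 : 0 < q.
Hypothesis delta_gt0 : 0 < delta.
Hypothesis C_ge0 : 0 <= C.

Let E k : R := C * (k.+1%:R `^ (-1 - delta)).

Hypothesis A_asym :
  forall k, (k0 <= k)%N -> `|A k - (q + alpha / k.+1%:R)| <= E k.
Hypothesis B_asym :
  forall k, (k0 <= k)%N -> `|B k - (q + beta / k.+1%:R)| <= E k.

Let E_ge0 k : 0 <= E k.
Proof. by rewrite mulr_ge0 // powR_ge0. Qed.

Lemma error_small e : 0 < e -> exists N, forall k, (N <= k)%N -> k.+1%:R * E k <= e.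
Proof.
move=> e0; have [] := @powRN_small _ delta (e / (C + 1)) delta_gt0.
  by rewrite divr_gt0 // ltr_wpDl.
move=> N HN; exists N => k /HN; rewrite ler_pdivlMr ?ltr_wpDl // => H.
have -> : k.+1%:R * E k = C * k.+1%:R `^ (- delta).
  rewrite /E mulrCA; congr (_ * _).
  rewrite -[X in X * _]powRr1 // -powRD ?addrA ?subrr ?sub0r //.
  by rewrite pnatr_eq0 implybT.
apply: le_trans H; rewrite mulrC ler_wpM2l ?powR_ge0 //; lra.
Qed.

Lemma ratio_limit e : 0 < e -> exists N, forall k, (N <= k)%N -> `|A k - q| <= e.
Proof.
move=> e0; have [N1 H1] := @error_small (e / 2) ltac:(lra).
have [N2 H2] := @invn_small R (e / 2 / (`|alpha| + 1)) ltac:(by rewrite divr_gt0 // ?ltr_wpDl //; lra).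
exists (maxn k0 (maxn N1 N2)) => k; rewrite !geq_max => /and3P[K0 /H1 K1 /H2].
rewrite ler_pdivlMr ?ltr_wpDl // => K2; have K3 := A_asym K0.
have n1 : 1 <= k.+1%:R :> R by rewrite ler1n.
have EE : E k <= k.+1%:R * E k by rewrite ler_peMl.
have t0 : 0 <= k.+1%:R^-1 :> R by rewrite invr_ge0.
have -> : A k - q = (A k - (q + alpha / k.+1%:R)) + alpha / k.+1%:R by ring.
apply: le_trans (ler_normD _ _) _; rewrite normrM (ger0_norm t0).
move: (k.+1%:R * E k) k.+1%:R^-1 (E k) `|A k - _| K1 K2 K3 EE t0 => x t y z.
by lra.
Qed.

Lemma ratio_bounded : q < beta - alpha ->
  exists M, forall N, \sum_(k < N) \prod_(i < k) (A i / B i) <= M.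
Proof.
move=> cq; have q0 := q_gt0; pose d := beta - alpha - q; have d0 : 0 < d by rewrite subr_gt0.
(* Raabe's condition holds eventually as soon as [g * q < beta - alpha]. This [g] puts [g * q]
   midway between [q] and [beta - alpha], and the remaining [d / 2] is split between the two kinds
   of error. *)
pose g := 1 + d / (2 * q).
have dq0 : 0 < d / (2 * q) by rewrite divr_gt0 // mulr_gt0.
have g1 : 1 < g by rewrite ltrDl.
have gq : g * q = q + d / 2 by rewrite /g; field; rewrite gt_eqF.
have b0 : 0 < g * (`|beta| + 1) by rewrite mulr_gt0 ?ltr_wpDl //; lra.
have [N1 H1] := @error_small (d / 4 / (2 + g)) ltac:(rewrite !divr_gt0 //; lra).
have [N2 H2] := @invn_small R (d / 4 / (g * (`|beta| + 1))) ltac:(by rewrite !divr_gt0).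
apply: (@sum_ratio_bounded _ _ _ A_gt0 B_gt0 g (maxn k0 (maxn N1 N2)) g1) => k.
rewrite !geq_max => /and3P[K0 /H1 K1 /H2 K2].
move: K1; rewrite ler_pdivlMr; last by lra.
move: K2; rewrite ler_pdivlMr //.
have := A_asym K0; have := B_asym K0; have := E_ge0 k.
move: (E k) (A k) (B k) => e a b e0.
have n1 : 1 <= k.+1%:R :> R by rewrite ler1n.
have nt : k.+1%:R * k.+1%:R^-1 = 1 :> R by rewrite mulfV // pnatr_eq0.
have t0 : 0 <= k.+1%:R^-1 :> R by rewrite invr_ge0.
move: k.+1%:R k.+1%:R^-1 n1 nt t0 => n t n1 nt t0.
rewrite !ler_norml => /andP[b1 b2] /andP[a1 a2] K2 K1.
have n0 : 0 <= n by lra.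
have g0 : 0 <= g by lra.
have na : n * a <= n * q + alpha * (n * t) + n * e.
  by have := ler_wpM2l n0 (_ : a <= q + alpha * t + e); lra.
have nb : n * q + beta * (n * t) - n * e <= n * b.
  by have := ler_wpM2l n0 (_ : q + beta * t - e <= b); lra.
have gb : g * b <= g * q + g * (`|beta| * t) + g * e.
  have bt : beta * t <= `|beta| * t by rewrite ler_wpM2r // ler_norm.
  by have := ler_wpM2l g0 (_ : b <= q + `|beta| * t + e); lra.
have ge : g * e <= g * (n * e) by rewrite ler_wpM2l // ler_peMl.
have gt : 0 <= g * t by rewrite mulr_ge0.
rewrite nt !mulr1 in na nb; rewrite mulrBl.
move: gq; rewrite /d => gq; rewrite /d in K1 K2; lra.
Qed.

Lemma ratio_unbounded : beta - alpha <= q ->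
  forall M : R, exists N, M <= \sum_(k < N) \prod_(i < k) (A i / B i).
Proof.
move=> cq; have q0 := q_gt0.
have [bb bb0 bbP] : exists2 bb : R, 0 <= bb & `|beta| <= bb by exists `|beta|.
have [K K0 T] : exists2 K : R, 0 < K & forall x : R, 1 <= x ->
    x `^ (-1 - delta) <= K * (x `^ (- delta) - (x + 1) `^ (- delta)).
  exists ((2 + delta) / delta); first by rewrite divr_gt0 // addr_gt0.
  by move=> x; exact: powRN_telescope.
have CK0 : 0 <= 3 * C * K by apply: mulr_ge0; [exact: mulr_ge0 | exact: ltW].
(* Even when [beta - alpha = q], the defect in the comparison is at most
   [bb / k.+1%:R + 3 * k%:R * E k]. Dividing by [k%:R * B k], with [B k >= q / 2], gives the
   decrement required of [v]: its first term telescopes [1 / (k * (k + 1))], its second the error,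
   by [powRN_telescope]. *)
pose v k : R := 2 / q * (bb / k%:R + 3 * C * K * k.+1%:R `^ (- delta)).
have v0 k : 0 <= v k.
  by rewrite mulr_ge0 ?divr_ge0 ?(ltW q_gt0) // addr_ge0 ?divr_ge0 // mulr_ge0 ?powR_ge0.
have vE k : (0 < k)%N ->
    2 / q * (bb / (k%:R * k.+1%:R) + 3 * E k) <= v k - v k.+1.
  move=> k0'; rewrite -mulrBr ler_pM2l ?divr_gt0 //.
  have T3 : 3 * E k <= 3 * C * K * (k.+1%:R `^ (- delta) - k.+2%:R `^ (- delta)).
    rewrite /E [leLHS]mulrA -[leRHS]mulrA ler_wpM2l ?mulr_ge0 //.
    by apply: le_trans (T _ _) _; rewrite ?ler1n // natr1.
  have -> : bb / (k%:R * k.+1%:R) = bb / k%:R - bb / k.+1%:R.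
    by rewrite -natr1; field; rewrite ?natr1 ?nat1r !pnatr_eq0 -?lt0n k0'.
  move: T3; rewrite mulrBr; move: (bb / _) (bb / _) (3 * E k) => a b x.
  move: (3 * C * K * _) (3 * C * K * _) => y z; lra.
have e0 : 0 < q / 16 / (3 * C * K + 1) by rewrite !divr_gt0 // ltr_wpDl.
have [N1 H1] := @powRN_small R delta _ delta_gt0 e0; clear e0.
have f0 : 0 < q / 16 / (bb + 1) by rewrite !divr_gt0 // ltr_wpDl.
have [N2 H2] := @invn_small R _ f0; clear f0.
have [N3 H3] := @error_small (q / 4) ltac:(by rewrite divr_gt0).
have [n [n0 n1 n2 n3]] : exists n,
    [/\ (k0 <= n)%N, (N1 <= n)%N, (N2 <= n)%N & (N3 <= n)%N].
  exists (maxn (maxn k0 N1) (maxn N2 N3)).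
  by rewrite !leq_max !leqnn ?orbT.
have vn : v n.+1 <= 1 / 2.
  have h1 := H1 _ (leqW n1); have h2 := H2 _ n2.
  move: h1 h2; rewrite !ler_pdivlMr ?ltr_wpDl // => h1 h2.
  rewrite /v -(@ler_pM2l _ (q / 2)); last by rewrite divr_gt0.
  have qq z : q / 2 * (2 / q * z * 2) = 2 * z by field; rewrite gt_eqF.
  rewrite qq.
  have F (t p : R) : 0 <= t -> 0 <= p -> p * (3 * C * K + 1) * 16 <= q ->
      t * (bb + 1) * 16 <= q -> 2 * (bb * t + 3 * C * K * p) <= q / 2 * 1.
    by move=> t0 p0 h1' h2'; lra.
  by apply: F h1 h2; rewrite ?invr_ge0 ?powR_ge0.
apply: (@sum_ratio_unbounded _ _ _ A_gt0 B_gt0 v n.+1) => // k nk.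
  rewrite -subr_ge0; apply: le_trans (vE k _); last by rewrite (leq_trans _ nk).
  by rewrite mulr_ge0 ?divr_ge0 ?(ltW q_gt0) // addr_ge0 ?divr_ge0 ?mulr_ge0.
have k1 : (0 < k)%N by rewrite (leq_trans _ nk).
have := vE k k1; move: (v k - v k.+1) => x.
have a1 := A_asym (leq_trans n0 (ltnW nk)).
have b1 := B_asym (leq_trans n0 (ltnW nk)).
have h3 := H3 _ (leq_trans n3 (ltnW nk)).
have := H2 _ (leq_trans n2 (ltnW nk)).
rewrite ler_pdivlMr ?ltr_wpDl // => h2.
have B0 := ltW (B_gt0 k).
have e1 := E_ge0 k; move: (E k) (A k) (B k) e1 a1 b1 h3 B0 => e a b e1 a1 b1 h3 B0.
have m1 : 1 <= k%:R :> R by rewrite ler1n.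
have nt : k.+1%:R * k.+1%:R^-1 = 1 :> R by rewrite mulfV // pnatr_eq0.
have t0 : 0 <= k.+1%:R^-1 :> R by rewrite invr_ge0.
have ms : k%:R * k%:R^-1 = 1 :> R by rewrite mulfV // pnatr_eq0 -lt0n.
rewrite invfM; move: k.+1%:R^-1 k%:R^-1 nt t0 ms h2 a1 b1 => t s.
move: h3; rewrite -natr1; move: k%:R m1 => m m1 h3 nt t0 ms h2.
rewrite !ler_norml => /andP[a1 a2] /andP[b1 b2] vE'.
have m0 : 0 <= m by lra.
move: bbP; rewrite ler_norml => /andP[bb1 bb2].
have bt : - (bb * t) <= beta * t by rewrite -mulNr ler_wpM2r.
have bq : q / 2 <= b.
  have me : 0 <= m * e by rewrite mulr_ge0.
  by lra.
have mb : m * b <= m * q + beta * (m * t) + m * e.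
  by have := ler_wpM2l m0 (_ : b <= q + beta * t + e); lra.
have m10 : 0 <= m + 1 by lra.
have na : (m + 1) * q + alpha * ((m + 1) * t) - (m + 1) * e <= (m + 1) * a.
  by have := ler_wpM2l m10 (_ : q + alpha * t - e <= a); lra.
have x0 : 0 <= x.
  apply: le_trans vE'; rewrite mulr_ge0 ?divr_ge0 ?(ltW q_gt0) // addr_ge0 ?mulr_ge0 //.
  have s0 : 0 <= m * s by rewrite ms.
  by rewrite -(pmulr_rge0 s (_ : 0 < m)) //; lra.
have mbx : bb * t + 3 * (m * e) <= m * b * x.
  apply: (@le_trans _ _ (m * (q / 2) * x)); last first.
    by rewrite ler_wpM2r // ler_wpM2l.
  have mq : 0 <= m * (q / 2) by rewrite mulr_ge0 // divr_ge0 // ltW.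
  apply: le_trans (ler_wpM2l mq vE').
  rewrite le_eqVlt; apply/orP; left; apply/eqP.
  transitivity ((m * s) * (bb * t) + 3 * (m * e)); first by rewrite ms mul1r.
  by field; rewrite gt_eqF.
have mt : m * t = 1 - t by lra.
have em : e <= m * e by rewrite ler_peMl.
rewrite nt mulr1 in na; rewrite mt in mb.
lra.
Qed.

End RatioAsymptotics.

(** * The trichotomy *)

Lemma positive_lower_bound (R : realType) (u : nat -> R) (kappa : R) N :
  (forall k, 0 < u k) -> 0 < kappa -> (forall k, (N <= k)%N -> kappa <= u k) ->
  exists2 kappa', 0 < kappa' & forall k, kappa' <= u k.
Proof.
move=> u0; elim: N kappa => [|N IH] kappa kappa0 H; first by exists kappa => // k; exact: H.
apply: (IH (Num.min kappa (u N))) => [|k]; first by rewrite lt_min kappa0 u0.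
rewrite leq_eqVlt => /orP[/eqP <-|/H]; first by rewrite ge_min lexx orbT.
by apply: le_trans; rewrite ge_min lexx.
Qed.

Theorem theorem1p1 (R : realType) (q delta : R) (c : bool -> R)
    (Q : nat -> bool -> bool -> R) :
  0 < q < 1 -> 0 < delta ->
  crw_kernel Q -> irreducible Q -> crw_asymptotics Q q c delta ->
  let cc := (c true + c false) / 2 in
  [/\ cc < - q -> forall s, valid_state s -> positive_recurrent Q s,
      q < cc -> forall s, valid_state s -> transient Q s &
      `|cc| <= q -> forall s, valid_state s -> null_recurrent Q s].
Proof.
move=> /andP[q0 q1] d0 Qker irr [C [x0 Cas]] cc.
have f0 := irreducible_fwd_gt0 Qker irr; have b0 := irreducible_bwd_gt0 Qker irr.
(* The sign in front of [c false] is negative in the law of a repeated down step, so the difference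
   of the two coefficients is the mean [cc]. *)
pose al := c true / 2; pose be := - c false / 2.
have ccE : cc = al - be by rewrite /cc /al /be; field.
have mono k : C * k.+1%:R `^ (-1 - delta) <= `|C| * k.+1%:R `^ (-1 - delta).
  by rewrite ler_wpM2r ?powR_ge0 // ler_norm.
have fas k : (x0 <= k)%N ->
    `|fwd Q k - (q + al / k.+1%:R)| <= `|C| * k.+1%:R `^ (-1 - delta).
  move=> xk; apply: le_trans (mono k).
  have [+ _] := Cas k.+1 true isT (leqW xk).
  by rewrite /sgn mul1r [2 * _]mulrC invfM mulrCA mulrA -/al -mulrA [_^-1 * _]mulrC.
have bas k : (x0 <= k)%N ->
    `|bwd Q k - (q + be / k.+1%:R)| <= `|C| * k.+1%:R `^ (-1 - delta).
  move=> xk; apply: le_trans (mono k).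
  have [+ _] := Cas k.+1 false isT (leqW xk).
  by rewrite /sgn mulN1r /be invfM mulrA.
(* Half the distance from [q] to the ends of the unit interval keeps [fwd] away from both 0 and
   1. *)
have [N Nq] : exists N, forall k, (N <= k)%N -> `|fwd Q k - q| <= Num.min q (1 - q) / 2.
  apply: (ratio_limit d0 (normr_ge0 C) fas).
  by rewrite divr_gt0 // lt_min q0 subr_gt0.
pose kap := Num.min q (1 - q) / 2.
have kap0 : 0 < kap by rewrite divr_gt0 // lt_min q0 subr_gt0.
have [kq kq1] : 2 * kap <= q /\ 2 * kap <= 1 - q.
  by rewrite /kap mulrC divfK // !ge_min !lexx orbT.
have fle k : (N <= k)%N -> fwd Q k <= 1 - kap.
  by move=> /Nq; rewrite ler_norml -/kap => /andP[_]; lra.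
have fge k : (N <= k)%N -> kap <= fwd Q k.
  by move=> /Nq; rewrite ler_norml -/kap => /andP[+ _]; lra.
have inv k : (weight Q k)^-1 = \prod_(i < k) (bwd Q i / fwd Q i).
  by rewrite /weight -prodfV; apply: eq_bigr => i _; rewrite invf_div.
split=> [cq|cq|/ler_normlP[cq1 cq2]] s vs.
- have [M wM] := ratio_bounded f0 b0 q0 d0 (normr_ge0 C) fas bas ltac:(lra).
  exact: positive_recurrent_weight wM.
(* Exchanging [bwd] and [fwd] turns the series of weights into that of their reciprocals and [cc]
   into its opposite. *)
- have [M wM] := ratio_bounded b0 f0 q0 d0 (normr_ge0 C) bas fas ltac:(lra).
  have [kap' kap'0 fge'] := positive_lower_bound f0 kap0 fge.
  pose m := Num.min kap kap'.
  apply: (@transient_weight _ _ Qker f0 b0 s M m N) => //.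
  + by move=> n; under eq_bigr do rewrite inv; exact: wM.
  + by rewrite lt_min kap0.
  + by move=> k; apply: le_trans (fge' k); rewrite ge_min lexx orbT.
  + move=> k /fle /le_trans; apply; rewrite lerD2l lerN2 ge_min lexx //.
(* The two bounds on [cc] make both series diverge, equality included. *)
- have wM := ratio_unbounded f0 b0 q0 d0 (normr_ge0 C) fas bas ltac:(lra).
  have vM := ratio_unbounded b0 f0 q0 d0 (normr_ge0 C) bas fas ltac:(lra).
  apply: (null_recurrent_weight Qker f0 b0 vs wM _ kap0 fle) => M.
  have [n Hn] := vM M; exists n.
  by under eq_bigr do rewrite inv.
Qed.
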